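(* Let $q\ge 4$ be an even integer (and $p=1$), and let $N^{+}(s)$ be the number of eigenvalues, counted with multiplicity, in $(0,s]$ of $\Box=-\Delta_x+\Delta_y$ on $S^1\times S^q$ ($x\in S^1$, $y\in S^q$); that is, $$N^{+}(s)=\sum_{\substack{j\in\mathbb{Z},\ k\in\mathbb{Z}_{\ge 0}\\ 0<j^2-k(k+q-1)\le s}}\frac{2k+q-1}{q-1}\binom{k+q-2}{k}.$$ Then, as $s\to\infty$, $$N^{+}(s)=\frac{4}{q!}\,(1-2^{-q})\,\zeta(q)\,s^{q}+O(s^{q-1}).$$
   Context: $\Delta_x,\Delta_y$ are the (nonpositive) Laplacians on $S^1=\mathbb{R}/2\pi\mathbb{Z}$ and on the standard unit sphere $S^q$. The eigenfunctions of $\Box$ are $e^{ijx}Y_k^q(y)$, $j\in\mathbb{Z}$, with $Y_k^q$ a spherical harmonic of degree $k\ge 0$ on $S^q$; the eigenvalue is $j^2-k(k+q-1)$, and the space of spherical harmonics of degree $k$ on $S^q$ has dimension $\frac{2k+q-1}{q-1}\binom{k+q-2}{k}$. $\zeta$ is the Riemann zeta function. The integer $q$ is fixed; the implied constant may depend on $q$. *)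

(* Defs.v *)
From mathcomp Require Import all_boot all_order all_algebra.
From mathcomp Require Import all_classical all_reals all_analysis.
Set Implicit Arguments.
Unset Strict Implicit.
Unset Printing Implicit Defensive.
Import Order.TTheory GRing.Theory Num.Theory.
Import numFieldNormedType.Exports.
Local Open Scope classical_set_scope.
Local Open Scope ring_scope.

(* Needed by the Landau notation [_ =O_+oo _]. *)
Canonical pinfty_filter_on (R : realType) := FilterType (pinfty_nbhs R) _.

(* [riemannR a n] is [(n.+1%:R `^ a)^-1], so the series starts at 1. Only the
   values at a > 1, where the series converges, are meaningful. *)
Definition zeta (R : realType) (a : R) : R := limn (series (riemannR a)).

(* Eigenvalue of - Delta_x + Delta_y on S^1 x S^q at e^{ijx} Y_k(y), with Y_k a
   spherical harmonic of degree k. Natural-number subtraction is not truncated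
   here nor in [sphharm_dim] as soon as q >= 2. *)
Definition box_eigenvalue (q : nat) (j : int) (k : nat) : int :=
  j ^+ 2 - (k * (k + q - 1))%N%:Z.

(* Dimension of the space of spherical harmonics of degree k on S^q. *)
Definition sphharm_dim (R : realType) (q k : nat) : R :=
  (2 * k + q - 1)%N%:R / (q - 1)%N%:R * 'C(k + q - 2, k)%:R.

Definition positive_modes (R : realType) (q : nat) (s : R) : set (int * nat) :=
  [set jk | 0 < box_eigenvalue q jk.1 jk.2
            /\ (box_eigenvalue q jk.1 jk.2)%:~R <= s].

(* [\sum_(_ \in _)] is 0 when infinitely many terms are nonzero. This does not
   occur for q even: 4 * box_eigenvalue q j k - (q - 1)^2 equals
   (2j - (2k + q - 1)) (2j + (2k + q - 1)), a product of two odd, hence nonzero,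
   integers, so bounding |box_eigenvalue q j k| leaves finitely many (j, k). *)
Definition Nplus (R : realType) (q : nat) (s : R) : R :=
  \sum_(jk \in positive_modes q s) sphharm_dim R q jk.2.

(* Main.v *)
Require Import Defs.
From mathcomp Require Import all_boot all_order all_algebra.
From mathcomp Require Import all_classical all_reals all_analysis.
From mathcomp Require Import ring lra zify.
Import Order.TTheory GRing.Theory Num.Theory.
Import numFieldNormedType.Exports.
Local Open Scope classical_set_scope.
Local Open Scope ring_scope.

(** Write q = 2h. By the symmetry j -> -j it suffices to count modes with j > 0,
    and for these put i = j - k - h, possibly negative. The eigenvalue becomes
    [(i + h)^2 + (2i + 1) k]: the modes with a given i >= 0 form a ray along
    which the eigenvalue is an arithmetic progression of step 2i + 1, hence
    always positive. The modes with i < 0 and a positive eigenvalue all lie in a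
    box independent of s, so they contribute O(1) ([Nplus_ray_sum]).

    The multiplicities along a ray telescope to two binomial coefficients
    ([sum_sphharm_dim]). The part of the ray i below s has about s/(2i + 1)
    points and therefore contributes about (2/q!) (s/(2i + 1))^q. The error is
    at most a constant times [(2i + 1) (s/(2i + 1))^(q-1)], and this also holds
    for the rays that start above s, which contribute 0 ([ray_sum_estimate]).
    As q >= 4, this error is O(s^(q-1) / (i + 1)^2), which is summable in i
    uniformly in s ([ray_sums_estimate]).

    For fixed s the number n of rays taken into account can be any large
    integer. Letting n tend to infinity in the estimate replaces the partial sums
    of (2i + 1)^(-q) by their limit (1 - 2^(-q)) zeta(q) ([cvg_sum_odd]), so
    no tail of the zeta series has to be estimated. The factor 4/q! is 2/q! for
    each of the two signs of j. *)

(** * Multiplicities *)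

(** The mean value bound for x^n, the source of every error term below. *)
Lemma exprB_le (R : realDomainType) (x y : R) (n : nat) :
  0 <= y -> y <= x -> x ^+ n - y ^+ n <= n%:R * (x - y) * x ^+ n.-1.
Proof.
move=> y0 yx; rewrite subrXX mulrAC [leRHS]mulrC ler_wpM2l ?subr_ge0//.
have x0 := le_trans y0 yx.
rewrite mulr_natl -[X in _ *+ X]card_ord -sumr_const; apply: ler_sum => i _.
have im : (i <= n.-1)%N by case: i => i /=; lia.
rewrite -[in leRHS](subnK im) exprD ler_wpM2l ?exprn_ge0//.
by rewrite lerXn2r// nnegrE.
Qed.

Lemma ffact_le_expn (n m : nat) : (n ^_ m <= n ^ m)%N.
Proof.
rewrite ffact_prod -[X in (_ <= _ ^ X)%N]card_ord -prod_nat_const.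
by apply: leq_prod => i _; rewrite leq_subr.
Qed.

Lemma expn_le_ffact (n m : nat) : ((n.+1 - m) ^ m <= n ^_ m)%N.
Proof.
rewrite ffact_prod -[X in (_ ^ X <= _)%N]card_ord -prod_nat_const.
by apply: leq_prod => i _; case: i => i /= im; lia.
Qed.

(** The sum is the dimension of the space of polynomials of degree less than c
    on S^q: modulo |y|^2 = 1, these are the homogeneous polynomials of degrees
    c - 1 and c - 2. In the proof, the dimension in degree c is the increment of
    the right-hand side, by Pascal's rule on each binomial. *)
Lemma sum_sphharm_dim (R : realType) (q c : nat) : (2 <= q)%N ->
  \sum_(k < c) sphharm_dim R q k = 'C(c + q - 1, q)%:R + 'C(c + q - 2, q)%:R.
Proof.
case: q => [|[|r]]// _; elim: c => [|c IH].
  by rewrite big_ord0 !bin_small ?addr0//; lia.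
rewrite big_ord_recr/= IH /sphharm_dim.
have -> : (c + r.+2 - 2 = c + r)%N by lia.
have -> : (c + r.+2 - 1 = (c + r).+1)%N by lia.
have -> : (c.+1 + r.+2 - 1 = (c + r).+2)%N by lia.
have -> : (c.+1 + r.+2 - 2 = (c + r).+1)%N by lia.
have -> : (r.+2 - 1 = r.+1)%N by lia.
have -> : (2 * c + r.+2 - 1 = (c + r).+1 + c)%N by lia.
have -> : 'C(c + r, c) = 'C(c + r, r) by rewrite -bin_sub ?leq_addr// addKn.
rewrite (binS (c + r).+1 r.+1) [X in _ = _ + X%:R](binS (c + r) r.+1)
  [(_ + _)%:R in RHS]natrD
  [X in _ = _ + X]natrD.
have r0 : r.+1%:R != 0 :> R by rewrite pnatr_eq0.
have E1 : (c + r).+1%:R * 'C(c + r, r)%:R = r.+1%:R * 'C((c + r).+1, r.+1)%:R :> R.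
  by rewrite -!natrM -mul_bin_diag.
have E2 : c%:R * 'C(c + r, r)%:R = r.+1%:R * 'C(c + r, r.+1)%:R :> R.
  by rewrite -!natrM mul_bin_left addnK.
rewrite [X in _ + _ + X = _]
  (_ : _ = 'C((c + r).+1, r.+1)%:R + 'C(c + r, r.+1)%:R); first by ring.
apply: (mulfI r0); rewrite mulrDr -E1 -E2; field.
by rewrite nat1r.
Qed.

(** Multiplied by q!, the two binomials are products of q consecutive integers
    between k and k + q, whence bounds without lower-order terms. *)
Lemma sum_sphharm_dim_bounds (R : realType) (q k : nat) : (2 <= q)%N ->
  k%:R ^+ q <= q`!%:R / 2 * (\sum_(l < k.+1) sphharm_dim R q l)
    <= (k + q)%:R ^+ q.
Proof.
move=> q2; rewrite sum_sphharm_dim//.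
have -> : (k.+1 + q - 1 = k + q)%N by lia.
have -> : (k.+1 + q - 2 = k + q - 1)%N by lia.
rewrite mulrAC mulrDr -!natrM ![(q`! * _)%N]mulnC !bin_ffact.
have l1 : (k ^ q <= (k + q) ^_ q)%N.
  by apply: leq_trans (expn_le_ffact _ _); rewrite leq_exp2r; lia.
have l2 : (k ^ q <= (k + q - 1) ^_ q)%N.
  by apply: leq_trans (expn_le_ffact _ _); rewrite leq_exp2r; lia.
have l3 := ffact_le_expn (k + q) q.
have l4 : ((k + q - 1) ^_ q <= (k + q) ^ q)%N.
  by apply: leq_trans (ffact_le_expn _ _) _; rewrite leq_exp2r; lia.
move: l1 l2 l3 l4; rewrite -!(ler_nat R) !natrX => l1 l2 l3 l4.
by apply/andP; split; lra.
Qed.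

(** * The series over odd integers *)

(** From the second term on, 1 / m^2 <= 1 / (m - 1) - 1 / m: the sum of n >= 1
    terms is at most 2 - 1/n. *)
Lemma sum_inv_square_le (R : realType) (n : nat) :
  \sum_(i < n) (i.+1%:R ^- 2 : R) <= 2.
Proof.
case: n => [|n]; first by rewrite big_ord0.
apply: (@le_trans _ _ (2 - n.+1%:R^-1)); last by rewrite lerBlDr lerDl invr_ge0.
elim: n => [|n IH]; first by rewrite big_ord_recr big_ord0 /= add0r expr1n invr1; lra.
rewrite big_ord_recr/=; apply: (le_trans (lerD IH (lexx _))).
rewrite -addrA lerD2l -subr_ge0.
have n0 : 0 < n.+1%:R :> R by [].
rewrite -[in n.+2]addn1 natrD; set x : R := n.+1%:R.
have -> : - (x + 1)^-1 - (- x^-1 + (x + 1) ^- 2) = x^-1 * (x + 1) ^- 2.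
  by field; apply/andP; split; lra.
by rewrite mulr_ge0 ?invr_ge0 ?exprn_ge0//; lra.
Qed.

Lemma cvg_zeta (R : realType) (q : nat) : (2 <= q)%N ->
  (fun n => \sum_(i < n) (i.+1%:R ^- q : R)) @ \oo --> zeta (q%:R : R).
Proof.
move=> q2.
have -> : (fun n => \sum_(i < n) (i.+1%:R ^- q : R)) = series (riemannR (q%:R : R)).
  apply/funext => n; rewrite /series/= big_mkord; apply: eq_bigr => i _.
  by rewrite /riemannR powR_mulrn.
apply: nondecreasing_is_cvgn.
  apply: nondecreasing_series => n _ _.
  by rewrite ltW// riemannR_gt0.
exists 2 => _ [n _ <-]; rewrite /series/= big_mkord.
apply: le_trans (sum_inv_square_le R n); apply: ler_sum => i _.
by rewrite /riemannR powR_mulrn// lef_pV2 ?posrE ?exprn_gt0// ler_weXn2l// ler1n.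
Qed.

(** The even terms among the first 2n terms of the zeta series are 2^(-q) times
    its first n terms; removing them leaves the first n odd terms. *)
Lemma cvg_sum_odd (R : realType) (q : nat) : (2 <= q)%N ->
  (fun n => \sum_(i < n) ((2 * i + 1)%:R ^- q : R)) @ \oo
    --> (1 - 2 ^- q) * zeta (q%:R : R).
Proof.
move=> q2; pose S n : R := \sum_(i < n) (i.+1%:R ^- q : R).
have -> : (fun n => \sum_(i < n) ((2 * i + 1)%:R ^- q : R)) =
    (fun n => S (2 * n)%N - 2 ^- q * S n).
  apply/funext; elim=> [|n IH]; first by rewrite /S !big_ord0; ring.
  rewrite big_ord_recr/= IH {IH} /S mulnS [(2 + _)%N]addnC addn2 !big_ord_recr/=.
  rewrite [in X in _ = _ - X]mulrDr -invfM -exprMn -natrM.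
  have -> : (2 * n.+1 = (2 * n).+2)%N by lia.
  by rewrite addn1; ring.
rewrite mulrBl mul1r; apply: cvgB; last by apply: cvgMl_tmp; exact: cvg_zeta.
rewrite -[X in X @ _ --> _]/(S \o (fun n => (2 * n)%N)).
apply: cvg_comp; last exact: cvg_zeta.
by apply/cvgnyPge => N; near=> n; rewrite (@leq_trans n)//; [near: n; exists N|lia].
Unshelve. all: by end_near. Qed.

(** * Contribution of one ray *)

(** Eigenvalue of the modes j = i + k + h and j = - (i + k + h) on S^1 x S^(2h);
    see [box_eigenvalue_ray]. *)
Definition ray_eigenvalue (h i k : nat) : nat := (i + h) ^ 2 + (2 * i + 1) * k.

Definition ray_length {R : realType} (h i : nat) (s : R) : nat :=
  if ((i + h) ^ 2)%:R <= s then
    (Num.truncn ((s - ((i + h) ^ 2)%:R) / (2 * i + 1)%:R)).+1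
  else 0.

Lemma ltn_ray_length (R : realType) (h i k : nat) (s : R) :
  (k < ray_length h i s)%N = ((ray_eigenvalue h i k)%:R <= s).
Proof.
have a0 : 0 < (2 * i + 1)%:R :> R by rewrite ltr0n addn1.
rewrite /ray_length /ray_eigenvalue.
move: (2 * i + 1)%N ((i + h) ^ 2)%N a0 => a b a0; rewrite natrD natrM; case: ifPn => bs.
  rewrite ltnS truncn_ge_nat; last by rewrite divr_ge0// subr_ge0.
  by rewrite ler_pdivlMr// lerBrDl mulrC.
apply/esym/negbTE; rewrite -!ltNge in bs *.
by apply: lt_le_trans bs _; rewrite lerDl mulr_ge0.
Qed.

(** If the ray starts below s then u >= 1, because
    2i + 1 <= (i + 1)^2 <= (i + h)^2 <= s; and its last index k satisfies
    u - 1 - h^2 (2i + 1) <= k <= u, because (i + h)^2 <= h^2 (2i + 1)^2. So both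
    k^q and (k + q)^q are within the stated distance of u^q. If the ray starts
    above s, the same inequality on (i + h)^2 gives u <= h^2 (2i + 1), and u^q
    itself is within the error term. *)
Lemma ray_sum_estimate (R : realType) (q h i : nat) (s : R) :
  (2 <= q)%N -> (0 < h)%N -> 0 <= s ->
  let u := s / (2 * i + 1)%:R in
  `|q`!%:R / 2 * (\sum_(k < ray_length h i s) sphharm_dim R q k) - u ^+ q|
    <= (q ^ 2 * q.+1 ^ q.-1 + q * (h ^ 2).+1)%:R * (2 * i + 1)%:R * u ^+ q.-1.
Proof.
move=> q2 h0 s0 /=; set a : R := (2 * i + 1)%:R; set u := s / a.
set K : R := (_ + _)%:R; set b : R := ((i + h) ^ 2)%:R.
have q1 : 1 <= q%:R :> R by rewrite ler1n; lia.
have a1 : 1 <= a by rewrite ler1n addn1.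
have a0 : 0 < a by lra.
have u0 : 0 <= u by rewrite divr_ge0// ltW.
have sE : s = u * a by rewrite divfK// gt_eqF.
have ab : a <= b by rewrite ler_nat; nia.
have bh : b <= (h ^ 2)%:R * a ^+ 2.
  by rewrite -natrX -natrM ler_nat -expnMn leq_exp2r//; nia.
have H0 : 0 <= (h ^ 2)%:R :> R by [].
have uq0 : 0 <= u ^+ q.-1 by rewrite exprn_ge0.
have uqE : u ^+ q = u * u ^+ q.-1 by rewrite -exprS prednK//; lia.
have KE : K = q%:R * q%:R * q.+1%:R ^+ q.-1 + q%:R * ((h ^ 2)%:R + 1).
  by rewrite /K; move: (h ^ 2)%N => H; rewrite -[H.+1]addn1 natrD !natrM natrD natrX.
have P0 : 0 <= q.+1%:R ^+ q.-1 :> R by rewrite exprn_ge0.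
(* The ray starts above s and is empty. *)
rewrite /ray_length -/b -/a; case: ifPn => [bs|]; last first.
  rewrite -ltNge => sb; rewrite big_ord0 mulr0 sub0r normrN ger0_norm ?exprn_ge0//.
  rewrite uqE ler_wpM2r//; apply: (@le_trans _ _ ((h ^ 2)%:R * a)).
    by rewrite -(ler_pM2r a0) -sE -mulrA -expr2; apply: le_trans bh; exact: ltW.
  rewrite ler_wpM2r ?(ltW a0)// KE; nra.
(* The ray starts below s; k is the index of its last mode. *)
set t := (s - b) / a; set k := Num.truncn t.
have t0 : 0 <= t by rewrite divr_ge0 ?subr_ge0.
have /andP[kt tk] := truncn_itv t0.
rewrite -/k in kt tk.
have tE : t = u - b / a by rewrite /t mulrBl.
have tu : t <= u by rewrite tE lerBlDr lerDl divr_ge0// ltW.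
have ut : u <= t + (h ^ 2)%:R * a.
  by rewrite tE -addrA lerDl addrC subr_ge0 ler_pdivrMr// -mulrA -expr2.
have u1 : 1 <= u by rewrite ler_pdivlMr// mul1r; exact: le_trans bs.
have /andP[lo hi] := sum_sphharm_dim_bounds R q k q2.
set A := _ * _ in lo hi *.
rewrite ler_norml; apply/andP; split.
  rewrite lerNl opprB; apply: (@le_trans _ _ (u ^+ q - k%:R ^+ q)).
    by rewrite lerD2l lerN2.
  apply: (le_trans (exprB_le _ _ _ q _ (le_trans kt tu))) => //.
  rewrite ler_wpM2r//; apply: (@le_trans _ _ (q%:R * (((h ^ 2)%:R + 1) * a))).
    rewrite ler_wpM2l//; move: tk; rewrite -natr1; lra.
  rewrite mulrA ler_wpM2r ?(ltW a0)// KE lerDr !mulr_ge0//.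
clearbody u; apply: (@le_trans _ _ ((u + q%:R) ^+ q - u ^+ q)).
  rewrite lerD2r; apply: le_trans hi _; rewrite lerXn2r ?nnegrE ?addr_ge0//.
  by rewrite natrD lerD2r; exact: le_trans tu.
apply: le_trans (exprB_le _ _ _ q u0 _) _; first by rewrite lerDl.
rewrite [u + _ - u]addrAC subrr add0r.
apply: (@le_trans _ _ (q%:R * q%:R * (q.+1%:R * u) ^+ q.-1)).
  rewrite ler_wpM2l ?mulr_ge0// lerXn2r ?nnegrE ?addr_ge0 ?mulr_ge0//.
  by rewrite -nat1r mulrDl mul1r lerD2l ler_peMr.
rewrite exprMn mulrA ler_wpM2r// KE.
apply: (@le_trans _ _ ((q%:R * q%:R * q.+1%:R ^+ q.-1 + q%:R * ((h ^ 2)%:R + 1)) * 1)).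
  by rewrite mulr1 lerDl mulr_ge0// addr_ge0.
by rewrite ler_wpM2l// addr_ge0 ?mulr_ge0// addr_ge0.
Qed.

(** * From modes to rays *)

Definition ray_mode (h : nat) (sgn : bool) (p : nat * nat) : int * nat :=
  ((-1) ^+ sgn * (p.1 + p.2 + h)%N%:Z, p.2).

Lemma box_eigenvalue_ray (h i k : nat) (sgn : bool) : (0 < h)%N ->
  box_eigenvalue h.*2 (ray_mode h sgn (i, k)).1 k = (ray_eigenvalue h i k)%:Z.
Proof.
case: h => // h _; rewrite /box_eigenvalue exprMn sqrr_sign mul1r.
rewrite /ray_eigenvalue (_ : (k + h.+1.*2 - 1 = k + 2 * h + 1)%N); last by lia.
by rewrite -[((i + h.+1) ^ 2)%N]/((i + h.+1) * (i + h.+1))%N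
  !(PoszD, PoszM) /= -addn1 PoszD; ring.
Qed.

Lemma positive_modes_ray (R : realType) (h i k : nat) (sgn : bool) (s : R) :
  (0 < h)%N -> positive_modes h.*2 s (ray_mode h sgn (i, k))
    <-> (ray_eigenvalue h i k)%:R <= s.
Proof.
move=> h0; rewrite /positive_modes /mkset -[(ray_mode _ _ _).2]/k.
rewrite box_eigenvalue_ray// -pmulrn; split=> [[]|ks] //; split => //.
by rewrite ltz_nat /ray_eigenvalue; nia.
Qed.

(** A box that contains all the modes of positive eigenvalue outside the rays.
    The removal of duplicates is for j = 0, listed with both signs. *)
Definition box_modes (h : nat) : seq (int * nat) :=
  undup [seq ((-1) ^+ (sk : bool * nat).1 * i%:Z, sk.2) | i <- iota 0 (h + h ^ 2),
     sk <- [seq (b, k) | b <- [:: true; false], k <- iota 0 (h ^ 2)]].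

(** From |j| <= k + h - 1 and k (k + 2h - 1) < j^2 one gets
    k < (h - 1)^2 after expanding (k + h - 1)^2. *)
Lemma mem_box_modes (h : nat) (jk : int * nat) :
  (`|jk.1| < jk.2 + h)%N -> 0 < box_eigenvalue h.*2 jk.1 jk.2 ->
  jk \in box_modes h.
Proof.
case: jk => j k /=; rewrite /box_eigenvalue => jkh j0.
have jE : j ^+ 2 = (`|j| ^ 2)%N%:Z by rewrite -abszX abszE; lia.
have j1 : (k * (k + h.*2 - 1) < `|j| ^ 2)%N by move: j0; rewrite jE; lia.
have j2 : (`|j| ^ 2 <= (k + h).-1 ^ 2)%N by rewrite leq_exp2r//; lia.
have kh : (k < h ^ 2)%N.
  case: h jkh j0 jE j1 j2 => [|h] jkh _ _ j1 j2; first by case: k jkh j1 j2 => //=; nia.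
  rewrite addnS/= in j2; rewrite doubleS !addnS -addn2 -muln2 in j1; nia.
rewrite mem_undup; apply/allpairsPdep.
exists `|j|%N, (j < 0, k); split.
- by rewrite mem_iota; lia.
- by apply/allpairsPdep; exists (j < 0), k; rewrite mem_iota; split; case: (j < 0).
- by rewrite /= -intEsign.
Qed.

Definition ray_points {R : realType} (h n : nat) (s : R) : seq (nat * nat) :=
  [seq (i, k) | i <- iota 0 n, k <- iota 0 (ray_length h i s)].

Lemma uniq_ray_points (R : realType) (h n : nat) (s : R) :
  uniq (ray_points h n s).
Proof.
apply: allpairs_uniq_dep => [|i _|]; rewrite ?iota_uniq//.
by move=> [i k] [j l] _ _ /= [-> ->].
Qed.

Lemma ray_pointsP (R : realType) (h n i k : nat) (s : R) : (0 < h)%N ->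
  s < n%:R -> ((i, k) \in ray_points h n s) = ((ray_eigenvalue h i k)%:R <= s).
Proof.
move=> h0 sn; rewrite -ltn_ray_length; apply/allpairsPdep/idP => /=.
  by move=> [i' [k' [_ + [-> ->]]]]; rewrite mem_iota.
move=> ks; exists i, k; split; rewrite ?mem_iota//=.
rewrite add0n -(ltr_nat R); apply: le_lt_trans sn.
rewrite ltn_ray_length in ks; apply: le_trans ks.
by rewrite ler_nat /ray_eigenvalue; nia.
Qed.

(** The set of modes is listed without repetition as the rays with j > 0, the
    rays with j < 0, and part of the box; the constant E is the total
    multiplicity of the box. The condition s < n ensures that the rays of index
    at least n start above s. *)
Lemma Nplus_ray_sum (R : realType) (h : nat) : (0 < h)%N ->
  exists E : R, forall (s : R) (n : nat), s < n%:R ->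
    0 <= Nplus h.*2 s -
      2 * \sum_(i < n) \sum_(k < ray_length h i s) sphharm_dim R h.*2 k <= E.
Proof.
move=> h0; pose d (jk : int * nat) := sphharm_dim R h.*2 jk.2.
have d0 jk : 0 <= d jk by rewrite /d /sphharm_dim !mulr_ge0// invr_ge0.
exists (\sum_(jk <- box_modes h) d jk) => s n sn.
pose r b := [seq ray_mode h b p | p <- ray_points h n s].
pose P jk := `[< positive_modes h.*2 s jk >] && (`|jk.1| < jk.2 + h)%N.
pose e := [seq jk <- box_modes h | P jk].
have rP b jk : jk \in r b -> (jk.2 + h <= `|jk.1|)%N /\ ((jk.1 < 0) = b).
  by case/mapP => -[i k] _ -> /=; rewrite abszMsign; split; case: b => /=; lia.
have uniqr b : uniq (r b).
  rewrite map_inj_in_uniq ?uniq_ray_points// => -[i k] [j l] _ _ [/(congr1 absz)].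
  by rewrite !abszMsign /= => + kl; rewrite kl => ?; congr pair; lia.
have uniqA : uniq (r false ++ r true ++ e).
  rewrite !cat_uniq !uniqr filter_uniq ?undup_uniq// andbT /=; apply/andP; split.
    apply/hasPn => jk; rewrite mem_cat; apply: contraTN => jkf.
    have [j1 j2] := rP _ _ jkf.
    rewrite mem_filter /P ltnNge j1 andbF orbF; apply/negP => /rP[_].
    by rewrite j2.
  apply/hasPn => jk; rewrite mem_filter => /andP[/andP[_ lt] _].
  by apply/negP => /rP[]; rewrite leqNgt lt.
have setA : positive_modes h.*2 s = [set` r false ++ r true ++ e].
  apply/seteqP; split => [[j k] jks|jk] /=.
    rewrite !mem_cat; have [lt|ge] := ltnP `|j|%N (k + h)%N.
      apply/orP; right; apply/orP; right; rewrite mem_filter /P lt andbT.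
      by apply/andP; split; [exact/asboolP|apply: mem_box_modes => //; case: jks].
    pose i := (absz j - (k + h))%N.
    have jE : (j, k) = ray_mode h (j < 0) (i, k).
      by rewrite /ray_mode /= /i -addnA subnK// -intEsign.
    have : (j, k) \in r (j < 0).
      rewrite [X in X \in _]jE; apply: map_f; rewrite ray_pointsP//.
      by move: jks; rewrite jE => /positive_modes_ray -/(_ h0).
    by case: (j < 0) => ->; rewrite ?orbT.
  rewrite !mem_cat => /or3P[| |]; last by rewrite mem_filter => /andP[/andP[/asboolP]].
    by case/mapP => -[i k]; rewrite ray_pointsP// => ks ->; exact/positive_modes_ray.
  by case/mapP => -[i k]; rewrite ray_pointsP// => ks ->; exact/positive_modes_ray.
have sumr b : \sum_(jk <- r b) d jk =
    \sum_(i < n) \sum_(k < ray_length h i s) sphharm_dim R h.*2 k.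
  have iotaE m (F : nat -> R) : \sum_(i <- iota 0 m) F i = \sum_(i < m) F i.
    by rewrite -(big_mkord xpredT) /index_iota subn0.
  by rewrite big_map big_allpairs_dep iotaE; apply: eq_bigr => i _; rewrite iotaE.
rewrite /Nplus setA -fsbig_seq// !big_cat/= !sumr.
set S := \sum_(i < n) _.
have -> : S + (S + \sum_(jk <- e) d jk) - 2 * S = \sum_(jk <- e) d jk by ring.
rewrite big_filter; apply/andP; split; first by apply: sumr_ge0 => *.
by rewrite big_mkcond; apply: ler_sum => jk _; case: ifP.
Qed.

(** * Summation over the rays *)

(** The error on the ray i is proportional to s^(q-1) (2i + 1)^(2-q), and here
    q >= 4 gives (2i + 1)^(2-q) <= (i + 1)^(-2). The bound is uniform in n, so
    that n may tend to infinity while s is fixed. *)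
Lemma ray_sums_estimate (R : realType) (q h n : nat) (s : R) :
  (4 <= q)%N -> (0 < h)%N -> 0 <= s ->
  `|\sum_(i < n) \sum_(k < ray_length h i s) sphharm_dim R q k
     - 2 / q`!%:R * (\sum_(i < n) (2 * i + 1)%:R ^- q) * s ^+ q|
    <= 4 / q`!%:R * (q ^ 2 * q.+1 ^ q.-1 + q * (h ^ 2).+1)%:R * s ^+ q.-1.
Proof.
move=> q4 h0 s0; set K : R := (_ + _)%:R.
have f0 : 0 < q`!%:R :> R by rewrite ltr0n fact_gt0.
rewrite mulr_sumr mulr_suml -sumrB.
apply: (le_trans (ler_norm_sum _ _ _)).
apply: (@le_trans _ _ (\sum_(i < n) (2 / q`!%:R * K * s ^+ q.-1 * i.+1%:R ^- 2))).
  apply: ler_sum => i _; have := ray_sum_estimate R q h i s (ltnW (ltnW q4)) h0 s0.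
  rewrite -/K /=; set S := \sum_(k < _) _; set a : R := (2 * i + 1)%:R.
  have a1 : 1 <= a by rewrite ler1n addn1.
  have a0 : 0 < a by lra.
  have -> : S - 2 / q`!%:R * a ^- q * s ^+ q =
      2 / q`!%:R * (q`!%:R / 2 * S - (s / a) ^+ q).
    by rewrite exprMn exprVn; field; rewrite expf_neq0 gt_eqF.
  rewrite normrM (gtr0_norm (divr_gt0 _ f0))// => le1.
  apply: (le_trans (ler_wpM2l _ le1)); first by rewrite divr_ge0// ltW.
  rewrite -!mulrA ler_wpM2l// ler_wpM2l ?invr_ge0 ?(ltW f0)// ler_wpM2l//.
  rewrite exprMn mulrCA ler_wpM2l ?exprn_ge0// exprVn.
  have -> : a / a ^+ q.-1 = a ^- q.-2.
    by rewrite -[q.-1]prednK ?exprS ?invfM ?mulVKf ?gt_eqF//; lia.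
  rewrite lef_pV2 ?posrE ?exprn_gt0//.
  apply: (@le_trans _ _ (a ^+ 2)); last by rewrite ler_weXn2l//; lia.
  by rewrite lerXn2r ?nnegrE ?(ltW a0)// ler_nat; lia.
rewrite -mulr_sumr.
have -> : 4 / q`!%:R * K * s ^+ q.-1 = 2 / q`!%:R * K * s ^+ q.-1 * 2 by ring.
by rewrite ler_wpM2l ?sum_inv_square_le// !mulr_ge0 ?exprn_ge0// invr_ge0 ltW.
Qed.

Theorem theorem5p2 (R : realType) (q : nat) (hq4 : (4 <= q)%N) (hq : ~~ odd q) :
  (fun s : R => Nplus q s - 4 / q`!%:R * (1 - 2 ^- q) * zeta q%:R * s ^+ q)
    =O_+oo (fun s : R => s ^+ (q - 1)).
Proof.
have qE := even_halfK hq; set h := q./2 in qE.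
have h0 : (0 < h)%N by lia.
have [E HE] := Nplus_ray_sum R h h0; rewrite qE in HE.
set C : R := 4 / q`!%:R * (q ^ 2 * q.+1 ^ q.-1 + q * (h ^ 2).+1)%:R.
apply/eqOP; near=> c; near=> s.
have s1 : 1 <= s by near: s; exact: nbhs_pinfty_ge.
have s0 : 0 <= s by lra.
have sq1 : 1 <= s ^+ q.-1 by rewrite exprn_ege1.
rewrite /= subn1 [in leRHS]ger0_norm ?exprn_ge0//.
apply: (@le_trans _ _ ((2 * C + E) * s ^+ q.-1)); last first.
  rewrite ler_wpM2r ?exprn_ge0//; near: c; exact: nbhs_pinfty_ge.
have E0 : 0 <= E.
  have /andP[] := HE s (Num.truncn s).+1 (real_truncnS_gt (num_real s)).
  exact: le_trans.
pose L : R := (1 - 2 ^- q) * zeta q%:R.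
suff : `|Nplus q s - 4 / q`!%:R * L * s ^+ q| <= 2 * C * s ^+ q.-1 + E.
  rewrite /L mulrA => /le_trans; apply.
  by rewrite [leRHS]mulrDl lerD2l ler_peMr.
pose v n : R := \sum_(i < n) (2 * i + 1)%:R ^- q.
have vL : v @ \oo --> L by apply: cvg_sum_odd; lia.
have : (fun n => `|Nplus q s - 4 / q`!%:R * v n * s ^+ q|) @ \oo -->
    `|Nplus q s - 4 / q`!%:R * L * s ^+ q|.
  apply: cvg_norm; apply: cvgB; first exact: cvg_cst.
  by apply: cvgMr_tmp; apply: cvgMl_tmp.
(* It suffices to bound the expression with v n in place of its limit L, for
   all n large enough in terms of s. *)
move/cvgr_to_le; apply; near=> n.
have sn : s < n%:R.
  apply: lt_le_trans (real_truncnS_gt (num_real s)) _; rewrite ler_nat.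
  by near: n; exact: nbhs_infty_ge.
have /andP[e0 e1] := HE s n sn.
have := ray_sums_estimate R q h n s hq4 h0 s0; rewrite -/C -/(v n).
set S := \sum_(i < n) _ in e0 e1 *.
rewrite !ler_norml => /andP[l1 l2].
have -> : 4 / q`!%:R * v n * s ^+ q = 2 * (2 / q`!%:R * v n * s ^+ q) by ring.
by apply/andP; split; lra.
Unshelve. all: by end_near. Qed.
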